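(* Let $(V,Y,\mathbf{1},T)$ consist of a $p$-adic Banach space $V$; a continuous $\mathbf{Q}_p$-linear map $Y\colon V\to\mathcal{F}(V)$, written $a\mapsto Y(a,z)=\sum_{n\in\mathbf{Z}}a(n)z^{-n-1}$; a distinguished state $\mathbf{1}\in V$ with $|\mathbf{1}|\le1$; and a linear endomorphism $T\in\mathrm{End}(V)$ with $T(\mathbf{1})=0$. Suppose that: (a) any two fields $Y(a,x)$, $Y(b,y)$ ($a,b\in V$) are mutually local, i.e. $\lim_{t\to\infty}(x-y)^t[Y(a,x),Y(b,y)]w=0$ for all $w\in V$; (b) the fields are creative with respect to $\mathbf{1}$: for all $a\in V$, $a(n)\mathbf{1}=0$ for $n\ge0$ and $a(-1)\mathbf{1}=a$; (c) the fields are translation covariant with respect to $T$: $[T,Y(a,z)]=\partial_zY(a,z)$ for all $a\in V$. Then $(V,Y,\mathbf{1})$ is a $p$-adic vertex algebra, and $T$ is its canonical derivation, i.e. $T(a)=a(-2)\mathbf{1}$ for all $a\in V$.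
   Context: A $p$-adic Banach space is a complete normed $\mathbf{Q}_p$-vector space $V$ with $|x+y|\le\sup(|x|,|y|)$ and $|v|\in|\mathbf{Q}_p|$ for all $v$. $\mathrm{End}(V)$ is the space of continuous $\mathbf{Q}_p$-linear endomorphisms of $V$ with the operator norm. A $p$-adic field on $V$ associated to a state $a\in V$ is a series $a(z)=\sum_{n\in\mathbf{Z}}a(n)z^{-n-1}\in\mathrm{End}(V)[[z,z^{-1}]]$ such that (1) there is $M\ge0$, depending on $a$, with $|a(n)b|\le M|a||b|$ for all $n\in\mathbf{Z}$, $b\in V$; (2) $\lim_{n\to\infty}a(n)b=0$ for all $b\in V$. $\mathcal{F}(V)$ is the space of $p$-adic fields on $V$ with norm $|a(z)|=\sup_n|a(n)|$. Limits of formal series in $x^{\pm1},y^{\pm1}$ with coefficients in $V$ are taken with respect to the sup-norm over all coefficients. A $p$-adic vertex algebra is a triple $(V,Y,\mathbf{1})$ with $V$ a $p$-adic Banach space, $\mathbf{1}\in V$, and $Y\colon V\to\mathcal{F}(V)$ a continuous $\mathbf{Q}_p$-linear map, $Y(a,z)=\sum_na(n)z^{-n-1}$ being a $p$-adic field associated to $a$, such that: (1) $|\mathbf{1}|\le1$; (2) $a(n)\mathbf{1}=0$ for $n\ge0$ and $a(-1)\mathbf{1}=a$ for all $a$; (3) (Jacobi identity) for all $r,s,t\in\mathbf{Z}$, $u,v,w\in V$, $$\sum_{i\ge0}\binom{r}{i}(u(t+i)v)(r+s-i)w=\sum_{i\ge0}(-1)^i\binom{t}{i}\{u(r+t-i)v(s+i)w-(-1)^tv(s+t-i)u(r+i)w\},$$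 where the infinite sums converge in $V$. *)

(* Defs.v *)
From HB Require Import structures.
From mathcomp Require Import all_boot all_order all_algebra.
From mathcomp Require Import all_classical all_reals all_analysis.

Set Implicit Arguments.
Unset Strict Implicit.
Unset Printing Implicit Defensive.

Import Order.TTheory GRing.Theory Num.Theory.
Import numFieldNormedType.Exports.

Local Open Scope classical_set_scope.
Local Open Scope ring_scope.

(* The norms below are plain functions rather than instances of the library's
   normed structures: normedZmodType requires `|x *+ n| = `|x| *+ n, which no
   nonzero p-adic space satisfies. *)
Section UltrametricNorms.
Variables (R : realType) (V : zmodType) (nrm : V -> R).

Definition ultrametric_norm : Prop :=
  [/\ forall x, 0 <= nrm x,
      forall x, nrm x = 0 <-> x = 0
    & forall x y, nrm (x + y) <= Num.max (nrm x) (nrm y)].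

Definition norm_cvg (u : nat -> V) (l : V) : Prop :=
  nrm (u n - l) @[n --> \oo] --> (0 : R).

Definition norm_cauchy (u : nat -> V) : Prop :=
  forall e : R, 0 < e -> exists N : nat,
    forall m n : nat, (N <= m)%N -> (N <= n)%N -> nrm (u m - u n) < e.

Definition norm_complete : Prop :=
  forall u, norm_cauchy u -> exists l, norm_cvg u l.

End UltrametricNorms.

Definition rat_pabs (R : realType) (p : nat) (q : rat) : R :=
  if q == 0 then 0
  else p%:R ^ ((logn p `|denq q|%N)%:Z - (logn p `|numq q|%N)%:Z).

(* Q_p, as the completion of Q for the p-adic absolute value; these axioms
   determine it up to a unique isometric field isomorphism. *)
Record padicNumbers (R : realType) (p : nat) := PadicNumbers {
  Qp_field :> fieldType;
  pabs : Qp_field -> R;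
  pabs_ultrametric : ultrametric_norm pabs;
  pabsM : forall x y, pabs (x * y) = pabs x * pabs y;
  pabs_ratr : forall q : rat, pabs (ratr q) = rat_pabs R p q;
  ratr_dense : forall (x : Qp_field) (e : R), 0 < e ->
    exists q : rat, pabs (x - ratr q) < e;
  pabs_complete : norm_complete pabs
}.

Record padicBanach (R : realType) (p : nat) (Qp : padicNumbers R p) :=
  PadicBanach {
  banach_space :> lmodType Qp;
  vnorm : banach_space -> R;
  vnorm_ultrametric : ultrametric_norm vnorm;
  vnormZ : forall (c : Qp) v, vnorm (c *: v) = pabs c * vnorm v;
  vnorm_value : forall v, exists c : Qp, vnorm v = pabs c;
  vnorm_complete : norm_complete vnorm
}.

Section Fields.
Variables (R : realType) (p : nat) (Qp : padicNumbers R p).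
Variable V : padicBanach Qp.

Local Notation nrmV := (@vnorm R p Qp V).

Definition in_End (f : V -> V) : Prop :=
  linear f /\
  forall (v : V) (e : R), 0 < e -> exists2 d : R, 0 < d &
    forall w : V, vnorm (w - v) < d -> vnorm (f w - f v) < e.

(* At v = 0 the quotient is 0 / 0 = 0, so the supremum is 0 when V = 0. *)
Definition op_norm (f : V -> V) : \bar R :=
  ereal_sup (range (fun v : V => (vnorm (f v) / vnorm v)%:E)).

(* A series sum_n a(n) z^{-n-1} is represented by its modes n |-> a(n). *)
Definition modes := int -> V -> V.

Definition field_of_state (a : V) (A : modes) : Prop :=
  [/\ forall n, in_End (A n),
      exists2 M : R, 0 <= M &
        forall n b, vnorm (A n b) <= M * vnorm a * vnorm b
    & forall b, norm_cvg nrmV (fun n : nat => A n%:Z b) 0].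

(* The space F(V). *)
Definition padic_field (A : modes) : Prop := exists a, field_of_state a A.

Definition field_norm (A : modes) : \bar R :=
  ereal_sup (range (fun n : int => op_norm (A n))).

Definition linear_state_field (Y : V -> modes) : Prop :=
  forall (c : Qp) (a b : V) (n : int) (v : V),
    Y (c *: a + b) n v = c *: Y a n v + Y b n v.

Definition continuous_state_field (Y : V -> modes) : Prop :=
  forall (a : V) (e : R), 0 < e -> exists2 d : R, 0 < d &
    forall b : V, vnorm (b - a) < d ->
      (field_norm (fun n v => Y b n v - Y a n v)%R < e%:E)%E.

Definition creative (vac : V) (Y : V -> modes) : Prop :=
  forall a, (forall n : int, 0 <= n -> Y a n vac = 0) /\ Y a (-1) vac = a.

(* Coefficient of z^k in sum_n a(n) z^{-n-1}. *)
Definition series_coef (A : modes) (k : int) : V -> V := A (- k - 1).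

(* Coefficient of z^k in the formal z-derivative. *)
Definition deriv_series (A : modes) (k : int) (v : V) : V :=
  series_coef A (k + 1) v *~ (k + 1).

Definition translation_covariant (T : V -> V) (A : modes) : Prop :=
  forall (k : int) (v : V),
    T (series_coef A k v) - series_coef A k (T v) = deriv_series A k v.

(* Formal series in x^{+-1}, y^{+-1}: F i j is the coefficient of x^i y^j. *)
Definition series2 := int -> int -> V.

Definition mul_x_sub_y (F : series2) : series2 := 
  fun i j => F (i - 1) j - F i (j - 1).

Definition commutator (A B : modes) (w : V) : series2 :=
  fun i j => series_coef A i (series_coef B j w) - series_coef B j (series_coef A i w).

Definition sup_norm2 (F : series2) : \bar R :=
  ereal_sup (range (fun ij : int * int => (vnorm (F ij.1 ij.2))%:E)).

Definition mutually_local (A B : modes) : Prop :=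
  forall w : V,
    sup_norm2 (iter t mul_x_sub_y (commutator A B w)) @[t --> \oo] --> 0%E.

Definition binomz (r : int) (i : nat) : Qp :=
  (\prod_(0 <= j < i) (r - j%:Z)%:~R) / (i`!)%:R.

Definition jacobi_lhs (Y : V -> modes) (r s t : int) (u v w : V) (i : nat) : V :=
  binomz r i *: Y (Y u (t + i%:Z) v) (r + s - i%:Z) w.

Definition jacobi_rhs (Y : V -> modes) (r s t : int) (u v w : V) (i : nat) : V :=
  ((-1) ^+ i * binomz t i) *:
    (Y u (r + t - i%:Z) (Y v (s + i%:Z) w)
     - ((-1 : Qp) ^ t) *: Y v (s + t - i%:Z) (Y u (r + i%:Z) w)).

Definition jacobi (Y : V -> modes) : Prop :=
  forall (r s t : int) (u v w : V), exists l : V,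
    norm_cvg nrmV (series (jacobi_lhs Y r s t u v w)) l /\
    norm_cvg nrmV (series (jacobi_rhs Y r s t u v w)) l.

Record padic_vertex_algebra (Y : V -> modes) (vac : V) : Prop :=
  PadicVertexAlgebra {
  pva_field : forall a, field_of_state a (Y a);
  pva_linear : linear_state_field Y;
  pva_continuous : continuous_state_field Y;
  pva_vacuum : vnorm vac <= 1;
  pva_creative : creative vac Y;
  pva_jacobi : jacobi Y
}.

End Fields.

(* Main.v *)
Require Import Defs.
From mathcomp Require Import all_boot all_order all_algebra.
From mathcomp Require Import all_classical all_reals all_analysis.
From mathcomp Require Import ring zify.

Set Implicit Arguments.
Unset Strict Implicit.
Unset Printing Implicit Defensive.

Import Order.TTheory GRing.Theory Num.Theory.
Import numFieldNormedType.Exports.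

Local Open Scope classical_set_scope.
Local Open Scope ring_scope.

(** The idea is to regard both sides of the Jacobi identity, for fixed u, v, w,
    as functions of (r, s, t). By Pascal's rule each of them satisfies
      D(r, s, t + 1) = D(r + 1, s, t) - D(r, s + 1, t),
    and each tends to 0 as t -> +oo, uniformly in r and s: the left-hand side
    because u(t)v tends to 0, the right-hand side because for t >= 0 it is the
    coefficient of (x - y)^t [Y(u,x), Y(v,y)] w and the fields are local. A
    solution of this recursion that vanishes at r = 0 and tends to 0 as
    t -> +oo is zero (recursion_small), so it suffices to treat r = 0, where
    the identity says that the field of u(t)v is the t-th product
      A(y) = Res_x ((x - y)^t Y(u,x) Y(v,y) - (x - y)^t Y(v,y) Y(u,x)),
    the two powers being expanded in |x| > |y| and in |y| > |x|.

    This is proved as in the classical theory by Goddard's uniqueness argument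
    (fieldprod_eq). The series B = A - Y(u(t)v) is covariant and B(-1)1 = 0,
    hence B(z)1 = 0; if moreover (y - z)^n B(y) Y(c,z) 1 tends to 0, then
    putting z = 0 gives y^n B(y) c -> 0, hence B(y) c = 0. The required
    locality of A against Y(c,z) on the vacuum is Dong's lemma (dong_local),
    obtained by expanding (y - z)^n = ((x - z) - (x - y))^n.

    The p-adic difficulty is that locality holds only pointwise: the rate at
    which (x - y)^t [Y(u,x), Y(v,y)] w tends to 0 depends on w, whereas Dong's
    lemma needs it for all the infinitely many vectors c(m)1 at once. These are
    the coefficients of e^(zT) c, and the t-th products are translation
    covariant (fieldprod_covariant), so that their values on e^(zT) c are
    governed by their values on c (covariant_exp). With recursion_small this
    makes locality uniform on the vectors c(m)1 (borcherds_lim_exp). *)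

(** * Norms of p-adic integers *)

Section PadicNumbers.
Variables (R : realType) (p : nat) (Qp : padicNumbers R p).
Hypothesis p_prime : prime p.

Lemma pabs_ge0 (x : Qp) : 0 <= pabs x.
Proof. by case: (pabs_ultrametric Qp). Qed.

Lemma pabs0 : pabs (0 : Qp) = 0.
Proof. by case: (pabs_ultrametric Qp) => _ /(_ 0) [_ ->]. Qed.

Lemma pabs1 : pabs (1 : Qp) = 1.
Proof.
have -> : (1 : Qp) = ratr (1%:Z)%:Q by rewrite ratr_int.
by rewrite pabs_ratr /rat_pabs intr_eq0 numq_int denq_int subrr expr0z.
Qed.

Lemma pabsN1 : pabs (-1 : Qp) = 1.
Proof.
have h : pabs (-1 : Qp) ^+ 2 = 1 by rewrite expr2 -pabsM mulrNN mulr1 pabs1.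
by apply/eqP; rewrite -(@eqrXn2 _ 2) ?pabs_ge0 ?ler01 // expr1n h.
Qed.

Lemma pabs_int_le1 (n : int) : pabs (n%:~R : Qp) <= 1.
Proof.
have nat_le1 k : pabs (k%:R : Qp) <= 1.
  elim: k => [|k IHk]; first by rewrite pabs0 ler01.
  rewrite -addn1 natrD.
  case: (pabs_ultrametric Qp) => _ _ /(_ k%:R 1) /le_trans; apply.
  by rewrite ge_max IHk pabs1 lexx.
case: n => k; first exact: nat_le1.
by rewrite NegzE rmorphN /= -mulN1r pabsM pabsN1 mul1r nat_le1.
Qed.

Lemma Qp_natr_neq0 (n : nat) : (0 < n)%N -> (n%:R : Qp) != 0.
Proof.
move=> n_gt0; apply/eqP => n0.
have : pabs (ratr n%:R : Qp) = 0 by rewrite ratr_nat n0 pabs0.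
rewrite pabs_ratr /rat_pabs pnatr_eq0 (gtn_eqF n_gt0) => /eqP.
by rewrite expfz_eq0 pnatr_eq0 (gtn_eqF (prime_gt0 p_prime)) andbF.
Qed.

Lemma pabs_natp : pabs (p%:R : Qp) = (p%:R : R)^-1.
Proof.
have -> : (p%:R : Qp) = ratr p%:R by rewrite ratr_nat.
rewrite pabs_ratr /rat_pabs pnatr_eq0 (gtn_eqF (prime_gt0 p_prime)).
have -> : (p%:R : rat) = (p%:Z)%:Q by [].
rewrite numq_int denq_int /= logn1 logn_prime // eqxx sub0r.
by rewrite -exprN1.
Qed.

Lemma small_scalar (d : R) : 0 < d -> exists2 c : Qp, c != 0 & pabs c < d.
Proof.
move=> d0; exists (p%:R ^+ Num.bound d^-1).
  by rewrite expf_neq0 // Qp_natr_neq0 // prime_gt0.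
have -> k : pabs ((p%:R : Qp) ^+ k) = (p%:R : R)^-1 ^+ k.
  by elim: k => [|k IHk]; rewrite ?pabs1 // !exprS pabsM IHk pabs_natp.
have p_gt0 : 0 < (p%:R : R) by rewrite ltr0n prime_gt0.
rewrite -[X in _ < X]invrK exprVn ltf_pV2 ?posrE ?exprn_gt0 ?invr_gt0 //.
apply: (lt_le_trans (archi_boundP _)); first by rewrite invr_ge0 ltW.
by rewrite -natrX ler_nat ltnW // ltn_expl // prime_gt1.
Qed.

Lemma binomz0 (r : int) : binomz Qp r 0 = 1.
Proof. by rewrite /binomz big_geq // fact0 divr1. Qed.

Lemma binomzS (r : int) (i : nat) :
  binomz Qp r i.+1 * (i.+1)%:R = (r - i%:Z)%:~R * binomz Qp r i.
Proof.
rewrite /binomz big_nat_recr //= factS natrM.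
have n0 : (i.+1%:R : Qp) != 0 := Qp_natr_neq0 (ltn0Sn i).
have f0 : (i`!%:R : Qp) != 0 := Qp_natr_neq0 (fact_gt0 i).
by move: (i.+1%:R) n0 (i`!%:R) f0 => N n0 F f0; field; rewrite f0 n0.
Qed.

Lemma binomz_absorb (r : int) (i : nat) :
  binomz Qp r i.+1 * (i.+1)%:R = r%:~R * binomz Qp (r - 1) i.
Proof.
elim: i => [|i IHi]; first by rewrite binomzS !binomz0 subr0.
rewrite binomzS.
have n0 := Qp_natr_neq0 (ltn0Sn i).
apply: (mulIf n0); rewrite -mulrA IHi -[RHS]mulrA binomzS.
have -> : r - 1 - i%:Z = r - i.+1%:Z by lia.
by ring.
Qed.

Lemma binomz_pascal (r : int) (i : nat) :
  binomz Qp (r + 1) i.+1 = binomz Qp r i.+1 + binomz Qp r i.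
Proof.
have n0 := Qp_natr_neq0 (ltn0Sn i).
apply: (mulIf n0); rewrite binomz_absorb addrK mulrDl binomzS.
by rewrite intrD rmorphB /= -natr1; ring.
Qed.

Lemma binomz0S (i : nat) : binomz Qp 0 i.+1 = 0.
Proof.
have n0 := Qp_natr_neq0 (ltn0Sn i).
by apply: (mulIf n0); rewrite binomz_absorb !mul0r.
Qed.

(** Generalized binomial coefficients are integers; Pascal's rule propagates
    this from the row r = 0 to all rows, in both directions. *)
Lemma pabs_binomz_le1 (r : int) (i : nat) : pabs (binomz Qp r i) <= 1.
Proof.
suff [z ->] : exists z : int, binomz Qp r i = z%:~R by exact: pabs_int_le1.
elim: i r => [r|i IHi]; first by exists 1; rewrite binomz0.
elim=> [|n [z hz]|n [z hz]]; first by exists 0; rewrite binomz0S.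
- have [z' hz'] := IHi n; exists (z + z').
  by rewrite intS addrC binomz_pascal hz hz' intrD.
- have [z' hz'] := IHi (- n.+1%:Z); exists (z - z').
  have := binomz_pascal (- n.+1%:Z) i.
  have -> : - n.+1%:Z + 1 = - n%:Z by lia.
  by rewrite hz hz' => zE; rewrite intrB zE addrK.
Qed.

End PadicNumbers.

(** * Null sequences and infinite sums *)

Section ConvergentSums.
Variables (R : realType) (p : nat) (Qp : padicNumbers R p).
Variable V : padicBanach Qp.
Implicit Types (x y v w : V) (e : R) (h : nat -> V).

Lemma vnorm_ge0 v : 0 <= vnorm v.
Proof. by case: (vnorm_ultrametric V). Qed.

Lemma vnorm0 : vnorm (0 : V) = 0.
Proof. by case: (vnorm_ultrametric V) => _ /(_ 0) [_ ->]. Qed.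

Lemma vnorm0_eq0 v : vnorm v = 0 -> v = 0.
Proof. by case: (vnorm_ultrametric V) => _ /(_ v) [+ _] _. Qed.

Lemma vnormD_le e x y : vnorm x <= e -> vnorm y <= e -> vnorm (x + y) <= e.
Proof.
move=> xe ye; case: (vnorm_ultrametric V) => _ _ /(_ x y) /le_trans; apply.
by rewrite ge_max xe.
Qed.

Lemma vnormN v : vnorm (- v) = vnorm v.
Proof. by rewrite -scaleN1r vnormZ pabsN1 mul1r. Qed.

Lemma vnormB_le e x y : vnorm x <= e -> vnorm y <= e -> vnorm (x - y) <= e.
Proof. by move=> xe ye; rewrite vnormD_le // vnormN. Qed.

Lemma vnormZ_le e (c : Qp) v : pabs c <= 1 -> vnorm v <= e -> vnorm (c *: v) <= e.
Proof.
move=> c1 ve; rewrite vnormZ (le_trans _ ve) //.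
by rewrite -[leRHS]mul1r ler_wpM2r // vnorm_ge0.
Qed.

Lemma vnorm_sum_le e (I : Type) (r : seq I) (P : pred I) (F : I -> V) :
  0 <= e -> (forall i, P i -> vnorm (F i) <= e) ->
  vnorm (\sum_(i <- r | P i) F i) <= e.
Proof.
move=> e0 Fe; elim/big_rec: _ => [|i x Pi xe]; first by rewrite vnorm0.
by rewrite vnormD_le // Fe.
Qed.

Lemma vnorm_le_eq0 v : (forall e, 0 < e -> vnorm v <= e) -> v = 0.
Proof.
move=> v_small; apply: vnorm0_eq0; apply/eqP; rewrite eq_le vnorm_ge0 andbT.
by apply/ler_addgt0Pr => e /v_small; rewrite add0r.
Qed.

Definition null h : Prop :=
  forall e, 0 < e -> exists N, forall n, (N <= n)%N -> vnorm (h n) <= e.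

Lemma norm_cvgP h v :
  norm_cvg (@vnorm R p Qp V) h v <-> null (fun n => h n - v).
Proof.
rewrite /norm_cvg; split=> [/cvgrPdist_le hv e /hv|hv].
  move=> [N _ hN]; exists N => n /hN /=.
  by rewrite sub0r normrN ger0_norm // vnorm_ge0.
apply/cvgrPdist_le => e /hv [N hN]; exists N => // n /= /hN.
by rewrite sub0r normrN ger0_norm // vnorm_ge0.
Qed.

Lemma null_eq h h' : h =1 h' -> null h -> null h'.
Proof. by move=> /funext ->. Qed.

Lemma null0 : null (fun=> 0).
Proof. by move=> e e0; exists 0 => n _; rewrite vnorm0 ltW. Qed.

Lemma nullD h h' : null h -> null h' -> null (fun n => h n + h' n).
Proof.
move=> hn hn' e e0; have [N hN] := hn e e0; have [N' hN'] := hn' e e0.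
exists (maxn N N') => n; rewrite geq_max => /andP[/hN he /hN' he'].
exact: vnormD_le.
Qed.

Lemma null_bound (c : R) h h' :
  (forall n, vnorm (h' n) <= c * vnorm (h n)) -> null h -> null h'.
Proof.
move=> hh' hn e e0.
have c1 : 0 < `|c| + 1 by rewrite ltr_wpDl ?normr_ge0.
have [N hN] := hn (e / (`|c| + 1)) (divr_gt0 e0 c1).
exists N => n /hN he; apply: (le_trans (hh' n)).
have /le_trans -> // : c * vnorm (h n) <= (`|c| + 1) * vnorm (h n).
  by rewrite ler_wpM2r ?vnorm_ge0 // (le_trans (ler_norm c)) // lerDl.
by rewrite mulrC -ler_pdivlMr.
Qed.

Lemma nullZ_le1 (c : nat -> Qp) h :
  (forall n, pabs (c n) <= 1) -> null h -> null (fun n => c n *: h n).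
Proof.
move=> c1; apply: (@null_bound 1) => n; rewrite mul1r.
exact: vnormZ_le.
Qed.

Lemma nullN h : null h -> null (fun n => - h n).
Proof. by move=> hn e /hn [N hN]; exists N => n /hN; rewrite vnormN. Qed.

Lemma nullB h h' : null h -> null h' -> null (fun n => h n - h' n).
Proof. by move=> hn /nullN; exact: nullD. Qed.

Lemma nullZ (c : Qp) h : null h -> null (fun n => c *: h n).
Proof. by apply: (@null_bound (pabs c)) => n; rewrite vnormZ. Qed.

Lemma null_shift h k : null h -> null (fun n => h (n + k)%N).
Proof.
by move=> hn e /hn [N hN]; exists N => n Nn; rewrite hN // (leq_trans Nn) // leq_addr.
Qed.

Lemma null_unshift h k : null (fun n => h (n + k)%N) -> null h.
Proof.
move=> hn e /hn [N hN]; exists (N + k)%N => n Nkn.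
have kn : (k <= n)%N by rewrite (leq_trans _ Nkn) // leq_addl.
by rewrite -(subnK kn) hN // leq_subRL // addnC.
Qed.

(** A block of consecutive terms is no larger than its largest term, so the
    partial sums are Cauchy. *)
Lemma null_series_cvg h :
  null h -> exists v, norm_cvg (@vnorm R p Qp V) (series h) v.
Proof.
move=> hn; apply: vnorm_complete => e e0.
have e2 : 0 < e / 2 by rewrite divr_gt0.
have [N hN] := hn _ e2.
have tail m n : (N <= m)%N -> (m <= n)%N ->
    vnorm (series h n - series h m) < e.
  move=> Nm mn; rewrite sub_series_geq //.
  apply: (@le_lt_trans _ _ (e / 2)); last by rewrite gtr_pMr // invf_lt1 // ltr1n.
  rewrite big_nat_cond; apply: vnorm_sum_le => [|i]; first by rewrite divr_ge0 // ltW.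
  by rewrite andbT => /andP[mi _]; rewrite hN // (leq_trans Nm).
exists N => m n Nm Nn; case/orP: (leq_total m n) => mn; last exact: tail.
by rewrite -vnormN opprB tail.
Qed.

(** The sum is chosen, with junk value 0 in the divergent case, so that it can
    be rewritten without carrying proofs of convergence. *)
Definition vsum h : V :=
  xget 0 [set v | norm_cvg (@vnorm R p Qp V) (series h) v].

Lemma norm_cvg_unique h v w :
  norm_cvg (@vnorm R p Qp V) h v -> norm_cvg (@vnorm R p Qp V) h w -> v = w.
Proof.
move=> /norm_cvgP hv /norm_cvgP hw; apply/eqP; rewrite -subr_eq0; apply/eqP.
apply: vnorm_le_eq0 => e e0; have [N hN] := nullB hw hv e0.
by have := hN N (leqnn N); rewrite opprB addrC addrA subrK.
Qed.

Lemma vsum_eq h v : norm_cvg (@vnorm R p Qp V) (series h) v -> vsum h = v.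
Proof.
by move=> hv; apply: xget_unique => // w hw; exact: norm_cvg_unique hw hv.
Qed.

Lemma vsumP h : null h -> null (fun n => series h n - vsum h).
Proof. by move=> /null_series_cvg [v hv]; rewrite (vsum_eq hv); exact/norm_cvgP. Qed.

Lemma vsumE h v : null (fun n => series h n - v) -> vsum h = v.
Proof. by move=> /norm_cvgP; exact: vsum_eq. Qed.

Lemma vsumD h h' : null h -> null h' ->
  vsum (fun n => h n + h' n) = vsum h + vsum h'.
Proof.
move=> /vsumP hn /vsumP hn'; apply: vsumE.
apply: null_eq (nullD hn hn') => n.
by rewrite /series /= big_split opprD addrACA.
Qed.

Lemma vsumZ (c : Qp) h : null h -> vsum (fun n => c *: h n) = c *: vsum h.
Proof.
move=> /vsumP hn; apply: vsumE; apply: null_eq (nullZ c hn) => n.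
by rewrite /series /= scalerBr scaler_sumr.
Qed.

Lemma vsum_le e h : 0 <= e -> null h -> (forall n, vnorm (h n) <= e) ->
  vnorm (vsum h) <= e.
Proof.
move=> e0 hn he; apply/ler_addgt0Pr => d d0.
have [N /(_ N (leqnn N)) hN] := vsumP hn d0.
rewrite -[vsum h](subrKC (series h N)) -opprB.
apply: vnormB_le; last by rewrite (le_trans hN) // lerDr.
by rewrite (@le_trans _ _ e) ?vnorm_sum_le // lerDl ltW.
Qed.

Lemma vsum_recl h : null h -> vsum h = h 0%N + vsum (fun n => h n.+1).
Proof.
move=> hn; have hn1 : null (fun n => h n.+1).
  by apply: null_eq (null_shift 1 hn) => n; rewrite addn1.
apply: vsumE; apply: (@null_unshift _ 1).
apply: null_eq (vsumP hn1) => n.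
by rewrite addn1 /series /= big_nat_recl // opprD addrA [h _ + _]addrC addrK.
Qed.

Lemma vsum0 : vsum (fun=> 0) = 0.
Proof. by apply: vsumE; apply: null_eq null0 => n; rewrite /series /= big1 // subrr. Qed.

End ConvergentSums.

(** * Sums weighted by binomial coefficients *)

Section BinomialSums.
Variables (R : realType) (p : nat) (Qp : padicNumbers R p).
Hypothesis p_prime : prime p.
Variable V : padicBanach Qp.
Implicit Types (e : R) (h : nat -> V).

(** Both sides of the Jacobi identity are sums of this shape. *)
Definition bsum (t : int) h : V := vsum (fun i => binomz Qp t i *: h i).

Lemma null_binomz t h : null h -> null (fun i => binomz Qp t i *: h i).
Proof. by apply: nullZ_le1 => i; exact: pabs_binomz_le1. Qed.

Lemma bsum_cvg t h : null h ->
  norm_cvg (@vnorm R p Qp V) (series (fun i => binomz Qp t i *: h i)) (bsum t h).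
Proof. by move=> /null_binomz hn; exact/norm_cvgP/vsumP. Qed.

Lemma bsumD t h h' : null h -> null h' ->
  bsum t (fun i => h i + h' i) = bsum t h + bsum t h'.
Proof.
move=> hn hn'; rewrite /bsum -vsumD; try exact: null_binomz.
by congr vsum; apply/funext => i; rewrite scalerDr.
Qed.

Lemma bsumZ t (c : Qp) h : null h -> bsum t (fun i => c *: h i) = c *: bsum t h.
Proof.
move=> hn; rewrite /bsum -vsumZ; last exact: null_binomz.
by congr vsum; apply/funext => i; rewrite !scalerA mulrC.
Qed.

Lemma bsumB t h h' : null h -> null h' ->
  bsum t (fun i => h i - h' i) = bsum t h - bsum t h'.
Proof.
move=> hn hn'; rewrite bsumD //; last exact: nullN.
rewrite -[X in _ = _ + X]scaleN1r -bsumZ //; congr (_ + bsum t _).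
by apply/funext => i; rewrite scaleN1r.
Qed.

Lemma bsum_le e t h : 0 <= e -> null h -> (forall i, vnorm (h i) <= e) ->
  vnorm (bsum t h) <= e.
Proof.
move=> e0 hn he; apply: vsum_le => //; first exact: null_binomz.
by move=> i; rewrite vnormZ_le // pabs_binomz_le1.
Qed.

Lemma null_succ h : null h -> null (fun i => h i.+1).
Proof. by move=> /(null_shift 1); apply: null_eq => i; rewrite addn1. Qed.

Lemma bsum_head t h : (forall i, h i.+1 = 0) -> bsum t h = h 0%N.
Proof.
move=> h0; have hn : null h.
  apply: (@null_unshift _ _ _ _ _ 1); apply: null_eq (@null0 _ _ _ V) => i.
  by rewrite addn1 h0.
rewrite /bsum vsum_recl; last exact: null_binomz.
rewrite binomz0 scale1r -[RHS]addr0; congr (_ + _); rewrite -[RHS](@vsum0 _ _ _ V).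
by congr vsum; apply/funext => i; rewrite h0 scaler0.
Qed.

Lemma bsum0z h : null h -> bsum 0 h = h 0%N.
Proof.
move=> hn; rewrite /bsum vsum_recl; last exact: null_binomz.
rewrite binomz0 scale1r -[RHS]addr0; congr (_ + _); rewrite -[RHS](@vsum0 _ _ _ V).
by congr vsum; apply/funext => i; rewrite binomz0S // scale0r.
Qed.

(** The source of the recursion that both sides of the Jacobi identity
    satisfy. *)
Lemma bsum_pascal t h : null h ->
  bsum (t + 1) h = bsum t h + bsum t (fun i => h i.+1).
Proof.
move=> hn; have hn1 := null_succ hn.
rewrite /bsum [LHS]vsum_recl; last exact: null_binomz.
rewrite [X in _ = X + _]vsum_recl; last exact: null_binomz.
rewrite !binomz0 -addrA -vsumD; last 2 first.
- exact: (null_succ (null_binomz _ hn)).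
- exact: null_binomz.
congr (_ + vsum _); apply/funext => i.
by rewrite binomz_pascal // scalerDl.
Qed.

(** The coefficient identity (t - i) C(t, i) = (i + 1) C(t, i + 1), summed. *)
Lemma bsum_absorb t h : null h ->
  bsum t (fun i => (t - i%:Z)%:~R *: h i.+1) = bsum t (fun i => i%:R *: h i).
Proof.
move=> hn; rewrite /bsum [RHS]vsum_recl; last first.
  apply: null_binomz; apply: nullZ_le1 => // i; exact: (pabs_int_le1 Qp i%:Z).
rewrite scale0r scaler0 add0r; congr vsum; apply/funext => i.
by rewrite !scalerA binomzS // mulrC.
Qed.

End BinomialSums.

(** * Continuous linear maps *)

Section LinearMaps.
Variables (R : realType) (p : nat) (Qp : padicNumbers R p).
Hypothesis p_prime : prime p.
Variables (V : padicBanach Qp) (f : V -> V).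
Hypothesis f_lin : linear f.

Lemma linB x y : f (x - y) = f x - f y.
Proof. exact: (zmod_morphism_linear f_lin). Qed.

Lemma linZ (c : Qp) x : f (c *: x) = c *: f x.
Proof. exact: (scalable_linear f_lin). Qed.

Lemma lin0 : f 0 = 0.
Proof. by rewrite -[X in f X](subrr 0) linB subrr. Qed.

Lemma linD x y : f (x + y) = f x + f y.
Proof.
have fN : f (- y) = - f y by rewrite -[in LHS](sub0r y) linB lin0 sub0r.
by rewrite -{1}[y]opprK linB fN opprK.
Qed.

Lemma lin_sum (I : Type) (r : seq I) (P : pred I) (F : I -> V) :
  f (\sum_(i <- r | P i) F i) = \sum_(i <- r | P i) f (F i).
Proof. exact: (big_morph f linD lin0). Qed.

Hypothesis f_End : in_End f.

Lemma in_End_null (h : nat -> V) : null h -> null (fun n => f (h n)).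
Proof.
move=> hn e e0; have [d d0 fd] := f_End.2 0 e e0.
have d2 : 0 < d / 2 by rewrite divr_gt0.
have [N hN] := hn _ d2.
exists N => n /hN hd; have := fd (h n); rewrite lin0 !subr0 => fe.
by rewrite ltW // fe // (le_lt_trans hd) // gtr_pMr // invf_lt1 // ltr1n.
Qed.

Lemma in_End_bsum t (h : nat -> V) :
  null h -> f (bsum t h) = bsum t (fun n => f (h n)).
Proof.
move=> hn; apply: esym; apply: vsumE.
apply: null_eq (in_End_null (vsumP (null_binomz p_prime t hn))) => n.
rewrite linB /series /= lin_sum; congr (_ - _).
by apply: eq_bigr => i _; rewrite linZ.
Qed.

End LinearMaps.

(** * Formal series and difference operators *)

Lemma pairD (A B : zmodType) (x y : A * B) : x + y = (x.1 + y.1, x.2 + y.2).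
Proof. by []. Qed.

Lemma pair_mulrn (A B : zmodType) (d : A * B) n : d *+ n = (d.1 *+ n, d.2 *+ n).
Proof. by elim: n => // n IHn; rewrite mulrS IHn [RHS]surjective_pairing /= !mulrS. Qed.

Lemma pair_mulrz (A B : zmodType) (d : A * B) n : d *~ n = (d.1 *~ n, d.2 *~ n).
Proof. by case: n => n; rewrite /intmul pair_mulrn. Qed.

Section DifferenceOperators.
Variables (R : realType) (p : nat) (Qp : padicNumbers R p).
Variables (V : padicBanach Qp) (I : zmodType).
Implicit Types (F G : I -> V) (d x y : I) (e : R).

(** A series is given by its modes, indexed by an abelian group I, which is
    int * int for two variables. Decay along d makes it possible to multiply by
    power series in the monomial of exponent d, such as y / x. *)
Definition decays d F : Prop := forall i, null (fun j => F (i + d *+ j)).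

Definition small e F : Prop := forall i, vnorm (F i) <= e.

(** Multiplication by the difference of two monomials: since the mode of index
    n is the coefficient of z^(-n-1), multiplying by z shifts n up by one. *)
Definition dop (d1 d2 : I) F : I -> V := fun i => F (i + d1) - F (i + d2).

Lemma decays_shift d F k : decays d F -> decays d (fun i => F (i + k)).
Proof. by move=> Fd i; apply: null_eq (Fd (i + k)) => j; rewrite addrAC. Qed.

Lemma decays_dop c d1 d2 F : decays c F -> decays c (dop d1 d2 F).
Proof. by move=> Fc i; apply: nullB; exact: decays_shift. Qed.

Lemma decays_iter_dop c d1 d2 F n : decays c F -> decays c (iter n (dop d1 d2) F).
Proof. by move=> Fc; elim: n => //= n; exact: decays_dop. Qed.

Lemma dopB c d F G :
  dop c d (fun i => F i - G i) = fun i => dop c d F i - dop c d G i.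
Proof. by apply/funext => i; rewrite /dop !opprD addrACA. Qed.

Lemma iter_dopB c d n F G :
  iter n (dop c d) (fun i => F i - G i)
  = fun i => iter n (dop c d) F i - iter n (dop c d) G i.
Proof. by elim: n => //= n ->; rewrite dopB. Qed.

Lemma dopC d1 d2 d1' d2' F : dop d1 d2 (dop d1' d2' F) = dop d1' d2' (dop d1 d2 F).
Proof.
have -> : dop d1' d2' F = fun i => F (i + d1') - F (i + d2') by [].
rewrite dopB; apply/funext => i.
by rewrite /dop; congr (_ - _ - (_ - _)); congr F; exact: addrAC.
Qed.

Lemma iter_dopC d1 d2 d1' d2' n F :
  dop d1 d2 (iter n (dop d1' d2') F) = iter n (dop d1' d2') (dop d1 d2 F).
Proof. by elim: n => //= n IHn; rewrite dopC IHn. Qed.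

Lemma dopD c d F G :
  dop c d (fun i => F i + G i) = fun i => dop c d F i + dop c d G i.
Proof. by apply/funext => i; rewrite /dop opprD addrACA. Qed.

Lemma iter_dopD c d n F G :
  iter n (dop c d) (fun i => F i + G i)
  = fun i => iter n (dop c d) F i + iter n (dop c d) G i.
Proof. by elim: n => //= n ->; rewrite dopD. Qed.

Lemma iter_iter_dopC c d c' d' m n F :
  iter m (dop c d) (iter n (dop c' d') F) = iter n (dop c' d') (iter m (dop c d) F).
Proof. by elim: m => //= m ->; rewrite iter_dopC. Qed.

Lemma small_dop e c d F : small e F -> small e (dop c d F).
Proof. by move=> Fe i; exact: vnormB_le. Qed.

Lemma small_iter_dop e c d n F : small e F -> small e (iter n (dop c d) F).
Proof. by move=> Fe; elim: n => //= n; exact: small_dop. Qed.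

(** The binomial expansion of (y - z) ^ n = ((x - z) - (x - y)) ^ n, in the form
    needed when all the terms are small. *)
Lemma dop_binomial x y z e n F :
  (forall a b, (a + b)%N = n ->
     small e (iter a (dop x y) (iter b (dop x z) F))) ->
  small e (iter n (dop y z) F).
Proof.
elim: n F => [|n IHn] F Fab; first exact: (Fab 0 0)%N.
rewrite iterSr; apply: IHn => a b abn.
have -> : dop y z F = fun i => dop x z F i - dop x y F i.
  by apply/funext => i; rewrite /dop opprB [RHS]addrC addrA subrK.
rewrite 2!iter_dopB => i; apply: vnormB_le.
- by have := Fab a b.+1; rewrite iterSr addnS abn => /(_ erefl i).
- by have := Fab a.+1 b; rewrite iterS iter_dopC iter_dopC addSn abn => /(_ erefl i).
Qed.

End DifferenceOperators.

(** Used when s freezes a variable whose mode is f, and when s exchanges two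
    variables. *)
Lemma iter_dop_slice (R : realType) (p : nat) (Qp : padicNumbers R p)
    (V : padicBanach Qp) (I J : zmodType) (s : J -> I) (c d : I) (c' d' : J)
    (f : V -> V) (F : I -> V) (G : J -> V) n :
  (forall j, s (j + c') = s j + c) -> (forall j, s (j + d') = s j + d) ->
  (forall x y, f (x - y) = f x - f y) -> (forall j, F (s j) = f (G j)) ->
  forall j, iter n (dop c d) F (s j) = f (iter n (dop c' d') G j).
Proof.
move=> sc sd fB FG; elim: n => //= n IHn j.
by rewrite /dop fB -!IHn sc sd.
Qed.

(** * Residues *)

Section Residues.
Variables (R : realType) (p : nat) (Qp : padicNumbers R p).
Hypothesis p_prime : prime p.
Variables (V : padicBanach Qp) (I : zmodType).
Implicit Types (F G : I -> V) (d x y : I) (e : R).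

Definition res_term x y F G (t : int) (i : I) (j : nat) : V :=
  (-1) ^+ j *: (F (i + x *~ t + (y - x) *+ j)
                - ((-1 : Qp) ^ t) *: G (i + y *~ t + (x - y) *+ j)).

(** The modes of (x - y)^t F - (x - y)^t G, where (x - y)^t is expanded in
    |x| > |y| in front of F and in |y| > |x| in front of G. *)
Definition res x y F G t i : V := bsum t (res_term x y F G t i).

Lemma pabs_signr (j : nat) : pabs ((-1 : Qp) ^+ j) = 1.
Proof. by elim: j => [|j IHj]; rewrite ?pabs1 // exprS pabsM IHj pabsN1 mulr1. Qed.

Lemma pabs_signz (t : int) : pabs ((-1 : Qp) ^ t) = 1.
Proof.
case: t => j; first exact: pabs_signr.
by rewrite NegzE -exprz_inv invrN1 pabs_signr.
Qed.

Lemma null_res_term x y F G t i :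
  decays (y - x) F -> decays (x - y) G -> null (res_term x y F G t i).
Proof.
move=> Fd Gd; apply: nullZ_le1 => [j|]; first by rewrite pabs_signr.
by apply: nullB; [exact: Fd | apply: nullZ; exact: Gd].
Qed.

Lemma res_le e x y F G t i : decays (y - x) F -> decays (x - y) G ->
  0 <= e -> small e F -> small e G -> vnorm (res x y F G t i) <= e.
Proof.
move=> Fd Gd e0 Fe Ge; apply: bsum_le => // [|j]; first exact: null_res_term.
apply: vnormZ_le; first by rewrite pabs_signr.
by apply: vnormB_le => //; apply: vnormZ_le; first by rewrite pabs_signz.
Qed.

Lemma res_0 x y F G i : decays (y - x) F -> decays (x - y) G ->
  res x y F G 0 i = F i - G i.
Proof.
move=> Fd Gd; rewrite /res bsum0z //; last exact: null_res_term.
by rewrite /res_term !mulr0z !mulr0n !addr0 expr0z !scale1r.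
Qed.

Lemma shift_move (i a x d : I) : i + (a + x) + d = i + x + a + d.
Proof. by rewrite addrA [i + a + x]addrAC. Qed.

Lemma shift_swap (i a x y d : I) : i + (a + x) + (y - x + d) = i + y + a + d.
Proof. rewrite addrA; congr (_ + d); rewrite -!addrA; congr (i + _).
by rewrite subrKC addrC.
Qed.

Lemma res_succ x y F G t i : decays (y - x) F -> decays (x - y) G ->
  res x y F G (t + 1) i = res x y F G t (i + x) - res x y F G t (i + y).
Proof.
move=> Fd Gd; rewrite /res bsum_pascal //; last exact: null_res_term.
rewrite -bsumD //; last 2 first.
- exact: null_res_term.
- exact: null_succ (null_res_term _ _ Fd Gd).
rewrite -bsumB //; try exact: null_res_term.
congr bsum; apply/funext => j; rewrite /res_term !mulrzDr !mulr1z !mulrS.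
have sgS : ((-1 : Qp) ^ (t + 1)) = - ((-1) ^ t).
  by rewrite exprzDr ?unitrN1 // expr1z mulrN1.
rewrite !shift_swap !shift_move exprS mulN1r scaleNr sgS !scaleNr !opprK.
rewrite -[LHS]scalerBr -[RHS]scalerBr; congr (_ *: _).
by rewrite !opprD !opprK addrACA [RHS]addrACA [- _ + _]addrC.
Qed.

Lemma resB x y F G F' G' t i :
  decays (y - x) F -> decays (x - y) G -> decays (y - x) F' -> decays (x - y) G' ->
  res x y (fun i => F i - F' i) (fun i => G i - G' i) t i
  = res x y F G t i - res x y F' G' t i.
Proof.
move=> Fd Gd Fd' Gd'; rewrite /res -bsumB //; try exact: null_res_term.
congr bsum; apply/funext => j; rewrite -scalerBr; congr (_ *: _).
by rewrite scalerBr !opprD !opprK addrACA.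
Qed.

Lemma res_shift x y F G t i d :
  res x y (fun i => F (i + d)) (fun i => G (i + d)) t i = res x y F G t (i + d).
Proof.
congr bsum; apply/funext => j; rewrite /res_term.
by congr (_ *: (F _ - _ *: G _)); rewrite -!addrA [X in _ = _ + X]addrC -!addrA.
Qed.

Lemma in_End_res (f : V -> V) x y F G t i : linear f -> in_End f ->
  decays (y - x) F -> decays (x - y) G ->
  f (res x y F G t i) = res x y (fun i => f (F i)) (fun i => f (G i)) t i.
Proof.
move=> f_lin f_End Fd Gd; rewrite /res in_End_bsum //; last exact: null_res_term.
by congr bsum; apply/funext => j; rewrite /res_term linZ // linB // linZ.
Qed.

Lemma res_dop x y F G t d1 d2 : decays (y - x) F -> decays (x - y) G ->
  res x y (dop d1 d2 F) (dop d1 d2 G) t = dop d1 d2 (res x y F G t).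
Proof.
move=> Fd Gd; apply/funext => i; rewrite resB; try exact: decays_shift.
by rewrite !res_shift.
Qed.

Lemma res_iter_dop x y F G t d1 d2 n : decays (y - x) F -> decays (x - y) G ->
  res x y (iter n (dop d1 d2) F) (iter n (dop d1 d2) G) t
  = iter n (dop d1 d2) (res x y F G t).
Proof.
move=> Fd Gd; elim: n => //= n <-.
by rewrite res_dop //; exact: decays_iter_dop.
Qed.

Lemma res_nat x y F G (n : nat) : decays (y - x) F -> decays (x - y) G ->
  res x y F G n%:Z = iter n (dop x y) (fun i => F i - G i).
Proof.
move=> Fd Gd; elim: n => [|n IHn] /=; first by apply/funext => i; rewrite res_0.
by apply/funext => i; rewrite -addn1 PoszD res_succ // IHn.
Qed.

End Residues.

Lemma res_slice (R : realType) (p : nat) (Qp : padicNumbers R p)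
    (V : padicBanach Qp) (I J : zmodType) (x y : I) (F G : J -> I -> V) t i :
  res (x, 0) (y, 0) (fun k => F k.2 k.1) (fun k => G k.2 k.1) t i
  = res x y (F i.2) (G i.2) t i.1.
Proof.
congr bsum; apply/funext => j.
by rewrite /res_term !pair_mulrn !pair_mulrz /= subrr mul0rz mul0rn !addr0.
Qed.

Lemma decays_slice (R : realType) (p : nat) (Qp : padicNumbers R p)
    (V : padicBanach Qp) (I J : zmodType) (d : I) (F : J -> I -> V) :
  (forall k, decays d (F k)) -> decays (d, 0) (fun k => F k.2 k.1).
Proof.
move=> Fd i; apply: null_eq (Fd i.2 i.1) => j.
by rewrite pair_mulrn /= mul0rn addr0.
Qed.

(** * From the hypotheses to modes *)

Definition eX : int * int := (1, 0).
Definition eY : int * int := (0, 1).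

Section StateFields.
Variables (R : realType) (p : nat) (Qp : padicNumbers R p).
Hypothesis p_prime : prime p.
Variables (V : padicBanach Qp) (Y : V -> modes V).

(** Continuity at 0 bounds the fields of all sufficiently small states by 1;
    rescaling a state to this size gives a bound that is uniform in the state. *)
Lemma state_field_bounded : (forall a, padic_field (Y a)) ->
  linear_state_field Y -> continuous_state_field Y ->
  exists2 C : R, 0 <= C &
    forall a n b, vnorm (Y a n b) <= C * vnorm a * vnorm b.
Proof.
move=> Y_field Y_lin Y_cont.
have [d d0 Yd] := Y_cont 0 1 ltr01.
have Y0 n v : Y 0 n v = 0.
  by have := Y_lin (-1) 0 0 n v; rewrite scaler0 addr0 scaleN1r addNr.
have YZ c a n v : Y (c *: a) n v = c *: Y a n v.
  by rewrite -[X in Y X]addr0 Y_lin Y0 addr0.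
have Y_small a n v : vnorm a < d -> vnorm (Y a n v) <= vnorm v.
  move=> ad; have [v0|v_gt0] := leP (vnorm v) 0.
    have -> : v = 0 by apply: vnorm0_eq0; apply/eqP; rewrite eq_le v0 vnorm_ge0.
    have [? [Y_End _ _]] := Y_field a.
    by rewrite (lin0 (Y_End n).1).
  have := Yd a; rewrite subr0 => /(_ ad) /ltW.
  have -> : (fun n v => Y a n v - Y 0 n v) = Y a.
    by apply/funext => k; apply/funext => w; rewrite Y0 subr0.
  move=> Ya1; rewrite -[leRHS]mul1r -ler_pdivrMr // -lee_fin.
  apply: (le_trans _ Ya1); apply: (@le_trans _ _ (op_norm (Y a n))).
    by apply: ereal_sup_ubound; exists v.
  by apply: ereal_sup_ubound; exists n.
have [c c0 cd] := small_scalar Qp p_prime d0.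
have pabs_gt0 (x : Qp) : x != 0 -> 0 < pabs x.
  move=> x0; rewrite lt_neqAle eq_sym pabs_ge0 andbT; apply: contra x0 => /eqP.
  by case: (pabs_ultrametric Qp) => _ xP _ /xP ->.
exists (pabs c)^-1 => [|a n b]; first by rewrite invr_ge0 pabs_ge0.
have [x ax] := vnorm_value a.
have [x0|x0] := eqVneq x 0.
  have -> : a = 0 by apply: vnorm0_eq0; rewrite ax x0 pabs0.
  by rewrite Y0 !vnorm0 mulr0 mul0r.
have pabsV (z : Qp) : z != 0 -> pabs z^-1 = (pabs z)^-1.
  move=> z0; apply: (mulfI (lt0r_neq0 (pabs_gt0 z z0))).
  by rewrite -pabsM !divff ?pabs1 // lt0r_neq0 ?pabs_gt0.
have -> : Y a n b = (x / c) *: Y ((c / x) *: a) n b.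
  by rewrite YZ scalerA mulrA divfK // divff // scale1r.
rewrite vnormZ pabsM pabsV // ax [_^-1 * _]mulrC.
rewrite ler_wpM2l ?divr_ge0 ?pabs_ge0 // Y_small //.
by rewrite vnormZ ax pabsM pabsV // divfK // lt0r_neq0 ?pabs_gt0.
Qed.

End StateFields.

Section Locality.
Variables (R : realType) (p : nat) (Qp : padicNumbers R p) (V : padicBanach Qp).

Lemma null_int (f : int -> V) (k : int) :
  null (fun j => f j%:Z) -> null (fun j => f (k + j%:Z)).
Proof.
case: k => k fn.
  by apply: null_eq (null_shift k fn) => j; rewrite -PoszD addnC.
apply: (@null_unshift _ _ _ _ _ k.+1); apply: null_eq fn => j.
by congr f; lia.
Qed.

(** Passing from the coefficient of x^i y^j to the mode (m, l), where i = -m-1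
    and j = -l-1. *)
Lemma iter_mul_x_sub_y (F : series2 V) (G : int * int -> V) n :
  (forall i, F (- i.1 - 1) (- i.2 - 1) = G i) ->
  forall i, iter n (@mul_x_sub_y _ _ _ V) F (- i.1 - 1) (- i.2 - 1) =
            iter n (dop eX eY) G i.
Proof.
move=> FG; elim: n => [|n IHn] i /=; first exact: FG.
rewrite /dop -!IHn /=; set H := iter n _ F; rewrite /mul_x_sub_y.
by congr (H _ _ - H _ _); lia.
Qed.

Lemma mutually_localP (A B : modes V) (w : V) (e : R) :
  mutually_local A B -> 0 < e ->
  exists N : nat, forall n, (N <= n)%N ->
    small e (iter n (dop eX eY) (fun i => A i.1 (B i.2 w) - B i.2 (A i.1 w))).
Proof.
move=> /(_ w) AB e0.
have e0' : (0 < e%:E)%E by rewrite lte_fin.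
have [N _ hN] := AB _ (open_ereal_lt' e0').
exists N => n Nn i; rewrite -(@iter_mul_x_sub_y (commutator A B w)).
  rewrite -lee_fin; apply: le_trans (ltW (hN n Nn)).
  by apply: ereal_sup_ubound; exists (- i.1 - 1, - i.2 - 1).
move=> {}i; rewrite /commutator /series_coef.
by congr (A _ (B _ w) - B _ (A _ w)); ring.
Qed.

End Locality.

(** * The recursion in r, s and t *)

Lemma pair_addE (i : int * int) (t : int) (j : nat) :
  (i + eX *~ t + (eY - eX) *+ j = (i.1 + t - j%:Z, i.2 + j%:Z)) *
  (i + eY *~ t + (eX - eY) *+ j = (i.1 + j%:Z, i.2 + t - j%:Z)).
Proof.
by rewrite !pair_mulrn !pair_mulrz; split; congr pair => /=; lia.
Qed.

Section RecursionUniqueness.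
Variables (R : realType) (p : nat) (Qp : padicNumbers R p) (V : padicBanach Qp).

(** Going up from r = 0, the recursion writes D(r + 1, s, t) as the sum of
    D(r, s, t + 1) and D(r, s + 1, t). Going down, it writes D(r, s, t) as the
    difference of D(r + 1, s - 1, t) and D(r, s - 1, t + 1); the first is
    controlled already, and iterating on the second pushes t to +oo, where D
    is small. *)
Lemma recursion_small (D : int -> int * int -> V) (t0 : int) (e : R) :
  0 <= e ->
  (forall t i, D (t + 1) i = D t (i + eX) - D t (i + eY)) ->
  (forall d : R, 0 < d -> exists N : int, forall t, N <= t -> small d (D t)) ->
  (forall t s, t0 <= t -> vnorm (D t (0, s)) <= e) ->
  forall t, t0 <= t -> small e (D t).
Proof.
move=> e0 Drec Dlim D0 t tt0 [r s].
have DX r' s' t' : D t' (r' + 1, s') = D (t' + 1) (r', s') + D t' (r', s' + 1).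
  rewrite Drec /= -[(r', s') + eX]/(r' + 1, s' + 0).
  by rewrite -[(r', s') + eY]/(r' + 0, s' + 1) !addr0 subrK.
elim: r s t tt0 => [|r IHr|r IHr] s t tt0; first exact: D0.
  by rewrite -addn1 PoszD DX vnormD_le // IHr // ler_wpDr.
(* At negative r the recursion is run the other way, k times. *)
apply/ler_addgt0Pr => d d0; have [N DN] := Dlim d d0.
have : exists k : nat, N <= t + k%:Z by exists `|N - t|%N; lia.
case=> k; elim: k s t tt0 => [|k IHk] s t tt0 Nt.
  by rewrite (le_trans (DN t _ _)) ?lerDr //; move: Nt; rewrite addr0.
have -> : D t (- r.+1%:Z, s) = D t (- r%:Z, s - 1) - D (t + 1) (- r.+1%:Z, s - 1).
  have -> : - r%:Z = - r.+1%:Z + 1 by lia.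
  by rewrite DX subrK addrAC subrr add0r.
apply: vnormB_le; first by rewrite (le_trans (IHr _ _ tt0)) // lerDl ltW.
by apply: IHk; lia.
Qed.

End RecursionUniqueness.

(** * The two products of a pair of fields *)

Section LocalFields.
Variables (R : realType) (p : nat) (Qp : padicNumbers R p).
Hypothesis p_prime : prime p.
Variables (V : padicBanach Qp) (Y : V -> modes V) (vac : V) (T : V -> V) (C : R).
Hypothesis C_ge0 : 0 <= C.
Hypothesis Y_bound : forall a n b, vnorm (Y a n b) <= C * vnorm a * vnorm b.
Hypothesis Y_End : forall a n, in_End (Y a n).
Hypothesis Y_null : forall a b, null (fun j => Y a j%:Z b).
Hypothesis vac_le1 : vnorm vac <= 1.
Hypothesis T_End : in_End T.
Hypothesis T_vac : T vac = 0.
Hypothesis Y_local : forall a b, mutually_local (Y a) (Y b).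
Hypothesis Y_creative : creative vac Y.
Hypothesis Y_cov : forall a, translation_covariant T (Y a).

Implicit Types (a b c u v w : V) (e : R).

Let T_lin : linear T := T_End.1.
Let Y_linr a n : linear (Y a n) := (Y_End a n).1.

Lemma Y_null_from a (k : int) b : null (fun j => Y a (k + j%:Z) b).
Proof. exact: (@null_int _ _ _ _ (fun n => Y a n b)). Qed.

(** The modes of Y(u,x) Y(v,y) w and of Y(v,y) Y(u,x) w; in both cases the
    first index belongs to x. *)
Definition modes_uv u v w : int * int -> V := fun i => Y u i.1 (Y v i.2 w).
Definition modes_vu u v w : int * int -> V := fun i => Y v i.2 (Y u i.1 w).

Lemma decays_uv u v w : decays (eY - eX) (modes_uv u v w).
Proof.
move=> i; apply: (@null_bound _ _ _ _ (C * vnorm u) _ _ _ (Y_null_from v i.2 w)).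
by move=> j; have := pair_addE i 0 j; rewrite !mulr0z !addr0 => -[-> _]; exact: Y_bound.
Qed.

Lemma decays_vu u v w : decays (eX - eY) (modes_vu u v w).
Proof.
move=> i; apply: (@null_bound _ _ _ _ (C * vnorm v) _ _ _ (Y_null_from u i.1 w)).
by move=> j; have := pair_addE i 0 j; rewrite !mulr0z !addr0 => -[_ ->]; exact: Y_bound.
Qed.

(** The right-hand side of the Jacobi identity at (r, s, t), for i = (r, s). *)
Definition borcherds u v w : int -> int * int -> V :=
  res eX eY (modes_uv u v w) (modes_vu u v w).

Lemma borcherds_succ u v w t i :
  borcherds u v w (t + 1) i = borcherds u v w t (i + eX) - borcherds u v w t (i + eY).
Proof. by apply: res_succ => //; [exact: decays_uv | exact: decays_vu]. Qed.

Lemma borcherds_nat u v w (n : nat) : borcherds u v w n%:Z =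
  iter n (dop eX eY) (fun i => modes_uv u v w i - modes_vu u v w i).
Proof. by apply: res_nat => //; [exact: decays_uv | exact: decays_vu]. Qed.

Lemma borcherds_lim u v w e : 0 < e ->
  exists N : int, forall t, N <= t -> small e (borcherds u v w t).
Proof.
move=> e0; have [N hN] := mutually_localP w (Y_local u v) e0.
exists N%:Z => -[n|//] Nn; rewrite borcherds_nat; exact: hN.
Qed.

Lemma borcherdsZ u v w (x : Qp) t i :
  borcherds u v (x *: w) t i = x *: borcherds u v w t i.
Proof.
rewrite /borcherds /res -bsumZ //; last first.
  by apply: null_res_term; [exact: decays_uv | exact: decays_vu].
have scalerC (y z : Qp) (v1 : V) : y *: (z *: v1) = z *: (y *: v1).
  by rewrite !scalerA mulrC.
congr bsum; apply/funext => j; rewrite /res_term /modes_uv /modes_vu.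
rewrite !(linZ (Y_linr _ _)).
by rewrite [X in _ - X]scalerC -scalerBr scalerC.
Qed.

(** * The exponential of T *)

(** The state a(-n-1)1, which is T^n a / n!. *)
Definition exp_coef (n : nat) a : V := Y a (- n%:Z - 1) vac.

Lemma exp_coef0 a : exp_coef 0 a = a.
Proof. by rewrite /exp_coef sub0r; case: (Y_creative a). Qed.

Definition covariant (A : int -> V -> V) : Prop :=
  forall n w, T (A n w) - A n (T w) = - (n%:~R *: A (n - 1) w).

Lemma Y_covariant a : covariant (Y a).
Proof.
move=> n w; have := Y_cov a (- n - 1) w; rewrite /deriv_series /series_coef.
have -> : - (- n - 1) - 1 = n by lia.
have -> : - (- n - 1 + 1) - 1 = n - 1 by lia.
by move=> ->; rewrite subrK mulrNz -scaler_int.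
Qed.

Lemma T_exp_coef n a : T (exp_coef n a) = n.+1%:R *: exp_coef n.+1 a.
Proof.
have := Y_covariant a (- n%:Z - 1) vac.
rewrite T_vac (lin0 (Y_linr _ _)) subr0 => ->.
rewrite -scaleNr -rmorphN /= /exp_coef.
have -> : - (- n%:Z - 1) = n.+1%:Z by lia.
by congr (_ *: Y a _ vac); lia.
Qed.

Lemma exp_coef_le n a : vnorm (exp_coef n a) <= C * vnorm a.
Proof.
apply: (le_trans (Y_bound _ _ _)).
by rewrite ler_piMr // mulr_ge0 // vnorm_ge0.
Qed.

(** A(z) e^(xT) = e^(xT) A(z - x) for a translation covariant series A. *)
Lemma covariant_exp (A : int -> V -> V) :
  covariant A -> (forall n (x : Qp) w, A n (x *: w) = x *: A n w) ->
  forall n m w, A m (exp_coef n w) =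
    \sum_(0 <= i < n.+1) binomz Qp m i *: exp_coef (n - i) (A (m - i%:Z) w).
Proof.
move=> Acov AZ; elim=> [|n IHn] m w.
  by rewrite big_nat1 binomz0 scale1r subr0 !exp_coef0.
have n0 : (n.+1%:R : Qp) != 0 by exact: Qp_natr_neq0.
apply: (scalerI n0); rewrite -AZ -T_exp_coef.
have -> : A m (T (exp_coef n w)) =
    T (A m (exp_coef n w)) + m%:~R *: A (m - 1) (exp_coef n w).
  by rewrite -[X in _ = _ + X]opprK -Acov opprB addrC subrK.
rewrite !IHn (lin_sum T_lin) !scaler_sumr.
have -> : \sum_(0 <= i < n.+2)
    n.+1%:R *: (binomz Qp m i *: exp_coef (n.+1 - i) (A (m - i%:Z) w)) =
  \sum_(0 <= i < n.+2)
    ((n.+1 - i)%:R * binomz Qp m i) *: exp_coef (n.+1 - i) (A (m - i%:Z) w)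
  + \sum_(0 <= i < n.+2)
    (i%:R * binomz Qp m i) *: exp_coef (n.+1 - i) (A (m - i%:Z) w).
  rewrite -big_split /=; apply: eq_big_nat => i /andP[_ ilt].
  by rewrite scalerA -scalerDl -mulrDl -natrD subnK.
rewrite [X in _ = X + _]big_nat_recr //= subnn mul0r scale0r addr0.
rewrite [X in _ = _ + X]big_nat_recl //= mul0r scale0r add0r.
congr (_ + _); apply: eq_big_nat => i /andP[_ ilt].
- by rewrite (linZ T_lin) T_exp_coef scalerA mulrC subSn.
- rewrite scalerA -binomz_absorb // mulrC.
  by congr (_ *: exp_coef _ (A _ w)); lia.
Qed.

Lemma covariant_exp_le (A : int -> V -> V) w e : covariant A ->
  (forall n (x : Qp) w, A n (x *: w) = x *: A n w) ->
  0 <= e -> (forall m, vnorm (A m w) <= e) ->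
  forall n m, vnorm (A m (exp_coef n w)) <= C * e.
Proof.
move=> Acov AZ e0 Ae n m; rewrite covariant_exp //.
apply: vnorm_sum_le => [|i _]; first by rewrite mulr_ge0.
apply: vnormZ_le; first exact: pabs_binomz_le1.
by rewrite (le_trans (exp_coef_le _ _)) // ler_wpM2l.
Qed.

(** * The products of two fields *)

(** The modes of the t-th product of the fields of u and v: the case r = 0 of
    the right-hand side of the Jacobi identity. *)
Definition fieldprod u v (t n : int) w : V := borcherds u v w t (0, n).

Lemma fieldprodZ u v t n (x : Qp) w : fieldprod u v t n (x *: w) = x *: fieldprod u v t n w.
Proof. exact: borcherdsZ. Qed.

Lemma T_modes_uv u v w m l : T (modes_uv u v w (m, l)) =
  modes_uv u v (T w) (m, l) - m%:~R *: modes_uv u v w (m - 1, l)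
  - l%:~R *: modes_uv u v w (m, l - 1).
Proof.
have Ycov a n x : T (Y a n x) = Y a n (T x) - n%:~R *: Y a (n - 1) x.
  by rewrite -Y_covariant addrC subrK.
rewrite /modes_uv /= Ycov Ycov (linB (Y_linr _ _)) (linZ (Y_linr _ _)).
by rewrite addrAC.
Qed.

Lemma T_modes_vu u v w m l : T (modes_vu u v w (m, l)) =
  modes_vu u v (T w) (m, l) - m%:~R *: modes_vu u v w (m - 1, l)
  - l%:~R *: modes_vu u v w (m, l - 1).
Proof.
have Ycov a n x : T (Y a n x) = Y a n (T x) - n%:~R *: Y a (n - 1) x.
  by rewrite -Y_covariant addrC subrK.
by rewrite /modes_vu /= Ycov Ycov (linB (Y_linr _ _)) (linZ (Y_linr _ _)).
Qed.

Lemma leibniz_cancel (x y n : Qp) (a f g : V) :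
  a - x *: f - (n + y) *: g - a + n *: g = - (x *: f) - y *: g.
Proof.
rewrite scalerDl opprD [a - _ + _ - a]addrAC [a - _ - a]addrAC subrr add0r.
by rewrite -addrA; congr (_ + _); rewrite addrAC addNr add0r.
Qed.

(** The term-by-term identity behind the covariance of the products. The
    scalars are sg = (-1)^j, tw = (-1)^t, x = t - j, y = j; the letters f, f'
    and g, g' are modes in the two orders. Up to a discrepancy that telescopes
    by bsum_absorb, T acts on the terms as on a field. *)
Lemma leibniz_term (sg tw x y n : Qp) (a b f f' g g' : V) :
  sg *: (a - x *: f' - (n + y) *: f - tw *: (b - y *: g' - (n + x) *: g))
  - sg *: (a - tw *: b) + n *: (sg *: (f - tw *: g))
  = x *: - (sg *: (f' - tw *: g)) - y *: (sg *: (f - tw *: g')).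
Proof.
have scalerC (c d : Qp) (h : V) : c *: (d *: h) = d *: (c *: h).
  by rewrite !scalerA mulrC.
rewrite scalerN (scalerC n) (scalerC x) (scalerC y).
rewrite -[X in _ = X - _]scalerN -[RHS]scalerBr.
rewrite -[X in X + _]scalerBr -[LHS]scalerDr; congr (_ *: _).
have regroup (a' b' : V) : a' - tw *: b' - (a - tw *: b) + n *: (f - tw *: g)
    = a' - a + n *: f - tw *: (b' - b + n *: g).
  rewrite (scalerDr tw) (scalerBr tw) (scalerBr n) (scalerC tw n).
  by rewrite !opprD [a' - _ + (_ - _)]addrACA [LHS]addrACA.
rewrite regroup.
rewrite !leibniz_cancel scalerBr scalerN (scalerBr x) (scalerBr y).
rewrite (scalerC tw y) (scalerC tw x).
by rewrite !opprD [RHS]addrACA; congr (_ + _); rewrite addrC.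
Qed.

Lemma fieldprod_covariant u v t : covariant (fieldprod u v t).
Proof.
move=> n w.
have Fd := decays_uv u v; have Gd := decays_vu u v.
have TFd x : decays (eY - eX) (fun i => T (modes_uv u v x i)).
  by move=> i; exact: (in_End_null T_lin T_End (Fd x i)).
have TGd x : decays (eX - eY) (fun i => T (modes_vu u v x i)).
  by move=> i; exact: (in_End_null T_lin T_End (Gd x i)).
rewrite /fieldprod /borcherds (in_End_res p_prime _ _ T_lin T_End) //.
apply/eqP; rewrite -addr_eq0; apply/eqP.
(* The Leibniz terms with scalar t - j assemble into k j.+1, those with scalar
   j into k j. *)
pose k (j : nat) : V := (-1) ^+ j *:
  (modes_uv u v w (t - j%:Z, n - 1 + j%:Z)
   - ((-1 : Qp) ^ t) *: modes_vu u v w (j%:Z - 1, n + t - j%:Z)).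
have kn : null k.
  apply: nullZ_le1 => [j|]; first by rewrite pabs_signr.
  apply: nullB; last apply: nullZ.
  - apply: null_eq (Fd w (t, n - 1)) => j.
    by have := pair_addE (t, n - 1) 0 j; rewrite !mulr0z !addr0 => -[-> _].
  - apply: null_eq (Gd w (-1, n + t)) => j.
    have := pair_addE (-1, n + t) 0 j; rewrite !mulr0z !addr0 => -[_ ->] /=.
    by rewrite [-1 + _]addrC.
rewrite /res -bsumZ -?bsumB -?bsumD //; try exact: null_res_term.
transitivity (bsum t (fun j => (t - j%:Z)%:~R *: k j.+1 - j%:R *: k j)); last first.
  rewrite bsumB ?bsum_absorb ?subrr //.
  - by apply: nullZ_le1; [move=> j; exact: pabs_int_le1 | exact: null_succ].
  - by apply: nullZ_le1 => // j; exact: (pabs_int_le1 Qp j%:Z).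
congr bsum; apply/funext => j; rewrite /res_term !pair_addE /= !add0r.
rewrite T_modes_uv T_modes_vu /k exprS mulN1r scaleNr. 
have -> : t - j.+1%:Z = t - j%:Z - 1 by lia.
have -> : n - 1 + j.+1%:Z = n + j%:Z by lia.
have -> : j.+1%:Z - 1 = j%:Z by lia.
have -> : n + t - j.+1%:Z = n + t - j%:Z - 1 by lia.
have -> : n - 1 + j%:Z = n + j%:Z - 1 by lia.
have -> : n - 1 + t - j%:Z = n + t - j%:Z - 1 by lia.
have -> : (n + t - j%:Z)%:~R = n%:~R + (t - j%:Z)%:~R :> Qp.
  by rewrite -addrA (intrD _ n).
rewrite (intrD _ n j%:Z).
exact: leibniz_term.
- by apply: nullB; exact: null_res_term.
- by apply: nullZ; exact: null_res_term.
Qed.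

(** On the vacuum only the term i = 0 of the first product survives. *)
Lemma borcherds_vac u v t r s : 0 <= r -> 0 <= s + 1 ->
  borcherds u v vac t (r, s) = Y u (r + t) (Y v s vac).
Proof.
move=> r0 s0; have Yvac0 := fun a => (Y_creative a).1.
rewrite /borcherds /res (bsum_head p_prime) => [|j]; rewrite /res_term !pair_addE /=.
- rewrite /modes_uv /modes_vu /= addr0 subr0 [Y u (r + 0) _]Yvac0 ?addr0 //.
  by rewrite (lin0 (Y_linr _ _)) scaler0 subr0 scale1r.
- rewrite /modes_uv /modes_vu /= !Yvac0 ?(lin0 (Y_linr _ _)) //; try lia.
  by rewrite scaler0 subrr scaler0.
Qed.

(** Locality on the vector c(m)1 is uniform in m: these vectors are the
    coefficients of e^(zT) c, and translation covariance moves e^(zT) past the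
    products of the two fields. *)
Lemma borcherds_lim_exp u v c e : 0 < e ->
  exists N : int, forall t, N <= t -> forall m,
    small e (borcherds u v (Y c m vac) t).
Proof.
move=> e0; have C1 : 0 < C + 1 by rewrite ltr_wpDl.
have e1 : 0 < e / (C + 1) by rewrite divr_gt0.
have [N hN] := borcherds_lim u v c e1; exists N => t Nt [m|m].
  rewrite (Y_creative c).1 // -[0](scale0r 0) => i.
  by rewrite borcherdsZ scale0r vnorm0 ltW.
have -> : Y c (Negz m) vac = exp_coef m c by congr (Y c _ vac); lia.
apply: (@recursion_small _ _ _ _ (borcherds u v (exp_coef m c)) N) => //.
- exact: ltW.
- exact: borcherds_succ.
- exact: borcherds_lim.
move=> t' s Nt'; apply: (@le_trans _ _ (C * (e / (C + 1)))).
  apply: (@covariant_exp_le (fieldprod u v t')).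
  - exact: fieldprod_covariant.
  - exact: fieldprodZ.
  - exact: ltW.
  - by move=> k; exact: hN.
by rewrite mulrCA ler_piMr ?ler_pdivrMr ?mul1r ?lerDl // ltW.
Qed.

(** * Products of local fields are local *)

Local Notation I3 := ((int * int) * int)%type.
Let eX3 : I3 := (eX, 0).
Let eY3 : I3 := (eY, 0).
Let eZ3 : I3 := (0, 1).

(** The modes of u(x) v(y) c(z) 1 - c(z) u(x) v(y) 1. *)
Definition passing u v c : I3 -> V := fun i =>
  Y u i.1.1 (Y v i.1.2 (Y c i.2 vac)) - Y c i.2 (Y u i.1.1 (Y v i.1.2 vac)).

(** The field c(z) is moved first past v(y), on the vacuum, which a power of
    y - z makes small, and then past u(x), on the vectors v(l)1, which a power
    of x - z makes small by the uniform form of locality. *)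
Lemma passing_small u v c e : 0 < e ->
  exists k : nat, forall j j', (k <= j)%N -> (k <= j')%N ->
    small e (iter j (dop eX3 eZ3) (iter j' (dop eY3 eZ3) (passing u v c))).
Proof.
move=> e0; have [K hK] := borcherds_lim_exp u c v e0.
have Cu : 0 < C * vnorm u + 1 by rewrite ltr_wpDl // mulr_ge0 // vnorm_ge0.
have e1 : 0 < e / (C * vnorm u + 1) by rewrite divr_gt0.
have [L hL] := mutually_localP vac (Y_local v c) e1.
exists (maxn `|K| L) => j j'; rewrite !geq_max => /andP[Kj _] /andP[_ Lj'].
pose P1 : I3 -> V := fun i =>
  Y u i.1.1 (Y v i.1.2 (Y c i.2 vac) - Y c i.2 (Y v i.1.2 vac)).
pose P2 : I3 -> V := fun i =>
  Y u i.1.1 (Y c i.2 (Y v i.1.2 vac)) - Y c i.2 (Y u i.1.1 (Y v i.1.2 vac)).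
have -> : passing u v c = fun i => P1 i + P2 i.
  by apply/funext => i; rewrite /P1 (linB (Y_linr _ _)) addrA subrK.
rewrite 2!iter_dopD => i; apply: vnormD_le.
- apply: small_iter_dop => {}i.
  pose s (k : int * int) : I3 := ((i.1.1, k.1), k.2).
  have -> : i = s (i.1.2, i.2) by case: i @s => -[].
  rewrite (@iter_dop_slice _ _ _ _ _ _ s eY3 eZ3 eX eY (Y u i.1.1) P1
    (fun k => Y v k.1 (Y c k.2 vac) - Y c k.2 (Y v k.1 vac))); last 4 first.
  + by move=> k; rewrite /s !pairD /= !addr0.
  + by move=> k; rewrite /s !pairD /= !addr0.
  + exact: (linB (Y_linr _ _)).
  + by [].
  apply: (le_trans (Y_bound _ _ _)).
  apply: (le_trans (ler_wpM2l _ (hL j' Lj' _))); first by rewrite mulr_ge0 ?vnorm_ge0.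
  by rewrite mulrCA ler_piMr ?ler_pdivrMr ?mul1r ?lerDl // ltW.
- rewrite iter_iter_dopC; apply: small_iter_dop => {}i.
  pose s (k : int * int) : I3 := ((k.1, i.1.2), k.2).
  have -> : i = s (i.1.1, i.2) by case: i @s => -[].
  rewrite (@iter_dop_slice _ _ _ _ _ _ s eX3 eZ3 eX eY id P2
    (fun k => Y u k.1 (Y c k.2 (Y v i.1.2 vac))
              - Y c k.2 (Y u k.1 (Y v i.1.2 vac)))) //; last 2 first.
  + by move=> k; rewrite /s !pairD /= !addr0.
  + by move=> k; rewrite /s !pairD /= !addr0.
  have := hK j%:Z _ i.1.2 (i.1.1, i.2); rewrite borcherds_nat; apply.
  by lia.
Qed.

(** The modes of A(y) c(z) 1 - c(z) A(y) 1, for A the t-th product of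
    the fields of u and v. The index r is kept so that multiplication by x - y
    raises t by one. *)
Definition dong u v c (t : int) : I3 -> V := fun i =>
  borcherds u v (Y c i.2 vac) t i.1 - Y c i.2 (borcherds u v vac t i.1).

Lemma dong_succ u v c t : dop eX3 eY3 (dong u v c t) = dong u v c (t + 1).
Proof.
apply/funext => i; rewrite /dong /dop /= !borcherds_succ (linB (Y_linr _ _)) !addr0.
by rewrite !opprD addrACA.
Qed.

Lemma dong_iter u v c t n :
  iter n (dop eX3 eY3) (dong u v c t) = dong u v c (t + n%:Z).
Proof.
elim: n t => [|n IHn] t; first by rewrite addr0.
by rewrite iterSr dong_succ IHn; congr dong; lia.
Qed.

Lemma dong_lim u v c e : 0 < e ->
  exists N : int, forall t, N <= t -> small e (dong u v c t).
Proof.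
move=> e0; have [N hN] := borcherds_lim_exp u v c e0.
have Cc : 0 < C * vnorm c + 1 by rewrite ltr_wpDl // mulr_ge0 // vnorm_ge0.
have e1 : 0 < e / (C * vnorm c + 1) by rewrite divr_gt0.
have [M hM] := borcherds_lim u v vac e1.
exists (Num.max N M) => t; rewrite ge_max => /andP[Nt Mt] i.
apply: vnormB_le; first exact: hN.
apply: (le_trans (Y_bound _ _ _)).
apply: (le_trans (ler_wpM2l _ (hM t Mt _))); first by rewrite mulr_ge0 ?vnorm_ge0.
by rewrite mulrCA ler_piMr ?ler_pdivrMr ?mul1r ?lerDl // ltW.
Qed.

(** The modes of v(y) u(x) c(z) 1 - c(z) v(y) u(x) 1, with the index of x
    first again. *)
Definition passing_swap u v c : I3 -> V := fun i => passing v u c ((i.1.2, i.1.1), i.2).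

Lemma dong_res u v c t :
  decays (eY3 - eX3) (passing u v c) /\ decays (eX3 - eY3) (passing_swap u v c) /\
  dong u v c t = res eX3 eY3 (passing u v c) (passing_swap u v c) t.
Proof.
pose F1 (m : int) := modes_uv u v (Y c m vac).
pose G1 (m : int) := modes_vu u v (Y c m vac).
pose F2 (m : int) := fun k => Y c m (modes_uv u v vac k).
pose G2 (m : int) := fun k => Y c m (modes_vu u v vac k).
have F1d : decays (eY3 - eX3) (fun k : I3 => F1 k.2 k.1).
  by apply: decays_slice => m; exact: decays_uv.
have G1d : decays (eX3 - eY3) (fun k : I3 => G1 k.2 k.1).
  by apply: decays_slice => m; exact: decays_vu.
have F2d : decays (eY3 - eX3) (fun k : I3 => F2 k.2 k.1).
  by apply: decays_slice => m i; apply: in_End_null => //; exact: decays_uv.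
have G2d : decays (eX3 - eY3) (fun k : I3 => G2 k.2 k.1).
  by apply: decays_slice => m i; apply: in_End_null => //; exact: decays_vu.
split; first by move=> i; apply: nullB; [exact: F1d | exact: F2d].
split; first by move=> i; apply: nullB; [exact: G1d | exact: G2d].
transitivity (res eX3 eY3 (fun k : I3 => F1 k.2 k.1 - F2 k.2 k.1)
                          (fun k : I3 => G1 k.2 k.1 - G2 k.2 k.1) t); last by [].
apply/funext => i; rewrite resB //.
rewrite (@res_slice _ _ _ _ _ _ eX eY F1 G1) (@res_slice _ _ _ _ _ _ eX eY F2 G2).
rewrite /dong; congr (_ - _).
apply: (in_End_res p_prime) => //; [exact: decays_uv | exact: decays_vu].
Qed.

Lemma dong_passing_small u v c e : 0 < e ->
  exists k : nat, forall j j' t, (k <= j)%N -> (k <= j')%N ->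
    small e (iter j (dop eX3 eZ3) (iter j' (dop eY3 eZ3) (dong u v c t))).
Proof.
move=> e0; have [k1 h1] := passing_small u v c e0.
have [k2 h2] := passing_small v u c e0.
exists (maxn k1 k2) => j j' t; rewrite !geq_max => /andP[j1 j2] /andP[j1' j2'].
have [Fd [Gd ->]] := dong_res u v c t.
rewrite -res_iter_dop // -res_iter_dop //; try exact: decays_iter_dop.
move=> i; apply: res_le => //; try (do 2!apply: decays_iter_dop => //).
- exact: ltW.
- exact: h1.
move=> {}i; pose s (k : I3) : I3 := ((k.1.2, k.1.1), k.2).
have sD k l : s (k + l) = s k + s l by [].
have [sX sY sZ] : [/\ s eX3 = eY3, s eY3 = eX3 & s eZ3 = eZ3] by [].
rewrite -(@iter_dop_slice _ _ _ _ _ _ s eY3 eZ3 eX3 eZ3 id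
  (iter j' (dop eX3 eZ3) (passing v u c))) //.
  by rewrite iter_iter_dopC; exact: h2.
by move=> k; apply: (@iter_dop_slice _ _ _ _ _ _ s eX3 eZ3 eY3 eZ3 id).
Qed.

(** Dong's lemma, on the vacuum: since y - z = (x - z) - (x - y), a high power of
    y - z is a sum of terms that contain either a high power of x - y, which
    raises t until locality of u and v applies, or high powers of x - z and
    y - z, which let c(z) pass through u(x) and v(y). *)
Lemma dong_local u v c t e : 0 < e ->
  exists K : nat, forall n, (K <= n)%N ->
    small e (iter n (dop eY3 eZ3) (dong u v c t)).
Proof.
move=> e0; have [N hN] := dong_lim u v c e0.
have [k hk] := dong_passing_small u v c e0.
(* Of two exponents with sum k + |N - t|, either that of x - z is at least k,
   or that of x - y lifts t above N. *)
exists (k + (k + `|N - t|))%N => n /subnK <-; rewrite iterD.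
apply: small_iter_dop; rewrite addnC iterD; apply: (@dop_binomial _ _ _ _ _ eX3).
move=> a b ab; have [kb|bk] := leqP k b.
  by apply: small_iter_dop; exact: hk.
rewrite iter_iter_dopC [X in iter b _ X]iter_iter_dopC dong_iter.
apply: small_iter_dop; apply: small_iter_dop; apply: hN; lia.
Qed.

(** The hypothesis says that F has no negative powers of z; putting z = 0 in
    (y - z)^N F leaves y^N F(y, 0), and z^0 is the mode -1. *)
Lemma iter_dop_edge (F : int * int -> V) N n :
  (forall n m, 0 <= m -> F (n, m) = 0) ->
  iter N (dop eX eY) F (n, -1) = F (n + N%:Z, -1).
Proof.
move=> F0.
have it0 k l m : 0 <= m -> iter k (dop eX eY) F (l, m) = 0.
  elim: k l m => [|k IHk] l m m0; first exact: F0.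
  by rewrite /= /dop !pairD /= !IHk ?subrr //; lia.
elim: N n => [|N IHN] n; first by rewrite addr0.
rewrite iterS {1}/dop.
have -> : (n, -1) + eX = (n + 1, -1) by [].
have -> : (n, -1) + eY = (n, 0) by rewrite pairD /= addr0.
rewrite (it0 _ n 0) // subr0 IHN.
by congr (F (_, _)); lia.
Qed.

(** Goddard's uniqueness argument: a translation covariant series that kills
    the vacuum and is local on the vacuum with all the fields is zero, because
    extracting the coefficient of z^0 from (y - z)^n B(y) c(z) 1 leaves
    y^n B(y) c. *)
Lemma fieldprod_eq u v t n c : fieldprod u v t n c = Y (Y u t v) n c.
Proof.
pose B k w := fieldprod u v t k w - Y (Y u t v) k w.
have Bcov : covariant B.
  move=> k w; rewrite /B (linB T_lin) opprD addrACA -opprD.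
  by rewrite fieldprod_covariant Y_covariant scalerBr opprB opprK addrC.
have Bvac k : B k vac = 0.
  have Bge k' : 0 <= k' + 1 -> B k' vac = 0.
    move=> k0; rewrite /B /fieldprod borcherds_vac // add0r.
    case: (Y_creative v) => v0 v1; case: (Y_creative (Y u t v)) => uv0 uv1.
    have [k1|k1] := leP 0 k'; first by rewrite v0 // uv0 // (lin0 (Y_linr _ _)) subr0.
    have -> : k' = -1 by lia.
    by rewrite v1 uv1 subrr.
  have [k0|k0] := leP 0 k; first by apply: Bge; lia.
  have -> : k = - (`|k|.-1)%:Z - 1 by lia.
  (* T B(-m-1)1 = (m + 1) B(-m-2)1, and the characteristic is zero. *)
  elim: (`|k|.-1) => [|m IHm]; first by apply: Bge.
  have := Bcov (- m%:Z - 1) vac; rewrite T_vac IHm (lin0 T_lin).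
  have -> : B (- m%:Z - 1) 0 = 0.
    by rewrite -[X in B _ X](scale0r vac) /B fieldprodZ (linZ (Y_linr _ _)) !scale0r subrr.
  have -> : - m%:Z - 1 - 1 = - m.+1%:Z - 1 by lia.
  have -> : - m%:Z - 1 = - m.+1%:Z by lia.
  rewrite subrr mulrNz scaleNr opprK => /esym /eqP.
  by rewrite scaler_eq0 (negbTE (Qp_natr_neq0 _ _ _)) //= => /eqP.
apply/eqP; rewrite -subr_eq0; apply/eqP; apply: vnorm_le_eq0 => e e0.
have [K1 h1] := dong_local u v c t e0.
have [K2 h2] := mutually_localP vac (Y_local (Y u t v) c) e0.
pose s (i : int * int) : I3 := ((0, i.1), i.2).
have Bc0 k m : 0 <= m -> B k (Y c m vac) = 0.
  move=> m0; rewrite (Y_creative c).1 // -(scale0r vac).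
  by rewrite /B fieldprodZ (linZ (Y_linr _ _)) !scale0r subrr.
have := iter_dop_edge (F := fun i => B i.1 (Y c i.2 vac)) (K1 + K2)
  (n - (K1 + K2)%:Z) Bc0.
rewrite /= subrK (Y_creative c).2 -/(B n c) => <-.
have -> : (fun i : int * int => B i.1 (Y c i.2 vac)) = fun i =>
    dong u v c t (s i)
    - (Y (Y u t v) i.1 (Y c i.2 vac) - Y c i.2 (Y (Y u t v) i.1 vac)).
  apply/funext => i; have Yc0 : Y c i.2 (B i.1 vac) = 0.
    by rewrite Bvac (lin0 (Y_linr _ _)).
  move: Yc0; rewrite /B (linB (Y_linr _ _)) => /eqP; rewrite subr_eq0 => /eqP Yc.
  by rewrite /dong /= -!/(fieldprod _ _ _ _ _) Yc opprB addrA subrK.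
rewrite iter_dopB; apply: vnormB_le; last by apply: h2; rewrite leq_addl.
rewrite -(@iter_dop_slice _ _ _ _ _ _ s eY3 eZ3 eX eY id (dong u v c t)) //.
by apply: h1; rewrite leq_addr.
Qed.

(** * The Jacobi identity *)

(** The left-hand side of the Jacobi identity at (r, s, t), for i = (r, s). *)
Definition iterate_sum u v w (t : int) (i : int * int) : V :=
  bsum i.1 (fun j => Y (Y u (t + j%:Z) v) (i.1 + i.2 - j%:Z) w).

Lemma null_iterate u v w t (f : nat -> int) :
  null (fun j => Y (Y u (t + j%:Z) v) (f j) w).
Proof.
apply: (@null_bound _ _ _ _ (C * vnorm w) _ _ _ (Y_null_from u t v)) => j.
by rewrite mulrAC; exact: Y_bound.
Qed.

(** The difference of the two sides satisfies the recursion and vanishes at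
    r = 0. *)
Lemma jacobi_sums u v w t i : iterate_sum u v w t i = borcherds u v w t i.
Proof.
apply/eqP; rewrite -subr_eq0; apply/eqP; apply: vnorm0_eq0.
apply/eqP; rewrite eq_le vnorm_ge0 andbT.
move: i; apply: (@recursion_small _ _ _ _
  (fun t i => iterate_sum u v w t i - borcherds u v w t i) t) => //.
- move=> {}t i; rewrite borcherds_succ.
  have -> : iterate_sum u v w (t + 1) i =
      iterate_sum u v w t (i + eX) - iterate_sum u v w t (i + eY).
    rewrite /iterate_sum !pairD /= !addr0 bsum_pascal //; last exact: null_iterate.
    apply/esym/eqP; rewrite subr_eq addrC; apply/eqP; congr (bsum _ _ + bsum _ _);
      apply/funext => j; congr (Y (Y u _ v) _ w); lia.
  by rewrite !opprD addrACA.
- move=> d d0; have [N hN] := borcherds_lim u v w d0.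
  have Cw : 0 < C * vnorm w + 1 by rewrite ltr_wpDl // mulr_ge0 // vnorm_ge0.
  have d1 : 0 < d / (C * vnorm w + 1) by rewrite divr_gt0.
  have [M hM] := Y_null u v d1.
  exists (Num.max N M%:Z) => t'; rewrite ge_max => /andP[Nt Mt] i.
  apply: vnormB_le; last exact: hN.
  apply: bsum_le => //; [exact: ltW | exact: null_iterate | move=> j].
  apply: (le_trans (Y_bound _ _ _)); rewrite mulrAC.
  have -> : t' + j%:Z = (`|t'| + j)%:Z by lia.
  apply: (le_trans (ler_wpM2l _ (hM _ _))); first by rewrite mulr_ge0 ?vnorm_ge0.
    by lia.
  by rewrite mulrCA ler_piMr ?ler_pdivrMr ?mul1r ?lerDl // ltW.
- move=> t' s _; rewrite /iterate_sum bsum0z //; last exact: null_iterate.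
  by rewrite -/(fieldprod u v t' s w) fieldprod_eq addr0 add0r subr0 subrr vnorm0.
Qed.

Lemma local_fields_jacobi : jacobi Y.
Proof.
move=> r s t u v w; exists (borcherds u v w t (r, s)); split.
- rewrite -jacobi_sums; apply: bsum_cvg => //; exact: null_iterate.
- have -> : jacobi_rhs Y r s t u v w = fun j => binomz Qp t j *:
      res_term eX eY (modes_uv u v w) (modes_vu u v w) t (r, s) j.
    apply/funext => j; rewrite /jacobi_rhs /res_term !pair_addE /= scalerA mulrC.
    by [].
  apply: bsum_cvg => //; apply: null_res_term; [exact: decays_uv | exact: decays_vu].
Qed.

End LocalFields.

(** * The theorem *)

Theorem theorem5p7 (R : realType) (p : nat) (p_prime : prime p)
    (Qp : padicNumbers R p) (V : padicBanach Qp)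
    (Y : V -> modes V) (vac : V) (T : V -> V)
    (Y_field : forall a, padic_field (Y a))
    (Y_linear : linear_state_field Y)
    (Y_continuous : continuous_state_field Y)
    (vac_le1 : vnorm vac <= 1)
    (T_End : in_End T)
    (T_vac : T vac = 0)
    (Y_local : forall a b, mutually_local (Y a) (Y b))
    (Y_creative : creative vac Y)
    (Y_covariant : forall a, translation_covariant T (Y a)) :
  padic_vertex_algebra Y vac /\ (forall a, T a = Y a (-2) vac).
Proof.
have [C C_ge0 Y_bound] := state_field_bounded p_prime Y_field Y_linear Y_continuous.
have Y_End a n : in_End (Y a n) by have [? []] := Y_field a.
have Y_null a b : null (fun j => Y a j%:Z b).
  have [? [_ _ /(_ b) /norm_cvgP Yn]] := Y_field a.
  by apply: null_eq Yn => j; rewrite subr0.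
split; last first.
  move=> a; have := Y_covariant a 0 vac; rewrite /deriv_series /series_coef T_vac.
  by rewrite (lin0 (Y_End a _).1) subr0 !add0r mulr1z (Y_creative a).2.
split=> //; last by apply: (@local_fields_jacobi R p Qp p_prime V Y vac T C).
move=> a; split=> //; first by exists C.
by move=> b; have [? []] := Y_field a.
Qed.
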